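(* Let $0<H<1$, $1-H<\alpha<1$, let $B^H$ be a (continuous) fractional Brownian motion with Hurst index $H$, and for $0\le t_2<t_1$ put $$X(t_1,t_2)=\frac{B^H_{t_1}-B^H_{t_2}}{(t_1-t_2)^{1-\alpha}}+\int_{t_2}^{t_1}\frac{B^H_u-B^H_{t_2}}{(u-t_2)^{2-\alpha}}\,du.$$ Then for every $p>1$ there exists a random variable $\xi=\xi(p)$ such that for all $0\le t_2<t_1$, $$|X(t_1,t_2)|\le \big((t_1^{H+\alpha-1}|\log t_1|^p)\vee 1\big)\,\xi(p),$$ and $\xi(p)$ has a Gaussian-type tail: there exist constants $B_1>0$, $C_1>0$, $\gamma>0$ and $\kappa\in(0,1)$ with $\kappa<2\gamma$ such that for all $\varepsilon>(2C_1+1)^{\frac{2\gamma}{2\gamma+\kappa}}$, $P\{\xi(p)>\varepsilon\}\le 2\exp\Big\{-\frac{(\varepsilon-\varepsilon^{\frac{\kappa}{2\gamma+\kappa}}(2C_1+1))^2}{2B_1^2}\Big\}$ (in particular $\xi(p)<\infty$ a.s.).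
   Context: A fractional Brownian motion with Hurst index $H\in(0,1)$ is a centered Gaussian process $B^H=\{B^H_t,t\ge0\}$ with $B^H_0=0$ and $EB^H_tB^H_s=\frac12(t^{2H}+s^{2H}-|t-s|^{2H})$; its continuous modification is used. Up to a constant factor, $X(t_1,t_2)$ is the Weyl–Marchaud fractional derivative $(\mathcal D^{1-\alpha}_{t_1-}B^H_{t_1-})(t_2)$. *)

(* Defs.v *)
From HB Require Import structures.
From mathcomp Require Import all_boot all_order all_algebra.
From mathcomp Require Import all_classical all_reals all_analysis.
From mathcomp Require Import measurable_realfun.
Set Implicit Arguments. Unset Strict Implicit. Unset Printing Implicit Defensive.
Import Order.TTheory GRing.Theory Num.Theory.
Import numFieldNormedType.Exports.
Local Open Scope classical_set_scope.
Local Open Scope ring_scope.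

Definition centered_gaussian d (T : measurableType d) (R : realType)
    (P : probability T R) (Y : T -> R) (v : R) : Prop :=
  measurable_fun setT Y /\
  (if v == 0 then P [set w | Y w != 0] = 0%E
   else forall A : set R, measurable A ->
          P (Y @^-1` A) = normal_prob 0 (Num.sqrt v) A).

Definition fbm_cov (R : realType) (H : R) (t s : R) : R :=
  (t `^ (2 * H) + s `^ (2 * H) - `|t - s| `^ (2 * H)) / 2.

Definition is_fBm d (T : measurableType d) (R : realType)
    (P : probability T R) (H : R) (B : R -> T -> R) : Prop :=
  (forall w, B 0 w = 0) /\
  (forall w, {within `[0, +oo[, continuous (fun t => B t w)}) /\
  (forall (n : nat) (t : 'I_n -> R) (a : 'I_n -> R),
     (forall i, 0 <= t i) ->
     centered_gaussian P (fun w => \sum_(i < n) a i * B (t i) w)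
       (\sum_(i < n) \sum_(j < n) a i * a j * fbm_cov H (t i) (t j))).

Definition Xfrac d (T : measurableType d) (R : realType)
    (alpha : R) (B : R -> T -> R) (w : T) (t1 t2 : R) : R :=
  (B t1 w - B t2 w) / (t1 - t2) `^ (1 - alpha) +
  Rintegral (@lebesgue_measure R) `]t2, t1[
    (fun u => (B u w - B t2 w) / (u - t2) `^ (2 - alpha)).

(* Main.v *)
Require Import Defs.
From HB Require Import structures.
From mathcomp Require Import all_boot all_order all_algebra.
From mathcomp Require Import all_classical all_reals all_analysis.
From mathcomp Require Import measurable_realfun.
From mathcomp Require Import zify lra ring.
Import Order.TTheory GRing.Theory Num.Theory.
Import numFieldNormedType.Exports.
Local Open Scope classical_set_scope.
Local Open Scope ring_scope.

(* Put b = (H + alpha - 1) / 2 and h = H - b, so that h + alpha - 1 = b > 0.  On the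
   scale [0, L] with L = e^(n+1), divide each increment of B over a dyadic interval of
   length L 2^-m by (n+1) L^H 2^(-m h), and let eta be the supremum over all scales n,
   levels m and intervals.  A normalised increment is Gaussian with variance
   2^(-2 b m) / (n+1)^2, so the union bound over the 2^m intervals of level m converges
   and gives P(eta > x) <= 8 exp(- x^2 / 4) for x^2 >= 4 / b.
   Chaining along dyadic approximations turns eta into a Hoelder constant of order h on
   [0, L], proportional to (n+1) L^(H-h) eta.  Since h > 1 - alpha, the singular integral
   in X converges and |X(t1, t2)| is at most a constant times (n+1) L^(H+alpha-1) eta
   whenever t1 <= L.  For n = floor(log t1), the factor n+1 is absorbed by |log t1|^p, so
   xi is a multiple of eta.  The tail bound asked for follows from that of eta with
   gamma = kappa = 1/2, C1 = 1 and B1 large. *)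

(** * Hoelder bounds from dyadic increments *)

Lemma powR2N_itv (R : realType) (h : R) : 0 < h -> 0 < (2 : R) `^ (- h) < 1.
Proof.
move=> h0; rewrite powR_gt0//= powRN invf_lt1 ?powR_gt0//.
have := gt0_ltr_powR h0 (_ : 1 \is Num.nneg) (_ : 2 \is Num.nneg).
by rewrite !nnegrE powR1; apply=> //; rewrite ltr1n.
Qed.

Lemma eq_or_succ (m n : nat) : (n <= m)%N -> (m < n.+2)%N -> m = n \/ m = n.+1.
Proof. lia. Qed.

Section dyadic.
Variables (R : realType) (f : R -> R) (L A r : R).
Hypotheses (L0 : 0 < L) (A0 : 0 <= A) (r01 : 0 < r < 1).
Hypothesis f_cont : {within `[0, +oo[, continuous f}.
Hypothesis f_incr : forall m k, (k < 2 ^ m)%N ->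
  `|f (k.+1%:R * L / 2 ^+ m) - f (k%:R * L / 2 ^+ m)| <= A * r ^+ m.

Let idx m (x : R) : nat := Num.truncn (x / L * 2 ^+ m).
Let grid m (x : R) : R := (idx m x)%:R * L / 2 ^+ m.

Let idx_itv m x : 0 <= x -> (idx m x)%:R <= x / L * 2 ^+ m < (idx m x).+1%:R.
Proof. by move=> x0; apply: truncn_itv; rewrite !mulr_ge0// ?invr_ge0// ltW. Qed.

Let idx_le m x : 0 <= x -> x <= L -> (idx m x <= 2 ^ m)%N.
Proof.
move=> x0 xL; rewrite -(ler_nat R) natrX.
have /andP[+ _] := idx_itv m x x0; move=> /le_trans; apply.
by rewrite ler_piMl// ler_pdivrMr// mul1r.
Qed.

(** Refining the subdivision either keeps the grid point below x or moves it right by one interval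
    of level m+1. At most one dyadic increment is involved, and r^(m+1) is at most r^m. *)
Let grid_step m x : 0 <= x -> x <= L ->
  `|f (grid m.+1 x) - f (grid m x)| <= A * r ^+ m.
Proof.
move=> x0 xL; have /andP[r0 r1] := r01.
have /andP[a1 a2] := idx_itv m x x0.
have /andP[b1 b2] := idx_itv m.+1 x x0.
have [e|e] : idx m.+1 x = (2 * idx m x)%N \/ idx m.+1 x = (2 * idx m x).+1.
  apply: eq_or_succ.
    rewrite -ltnS -(ltr_nat R) natrM; apply: le_lt_trans b2.
    by rewrite exprS mulrCA ler_pM2l.
  - rewrite -(ltr_nat R); apply: (le_lt_trans b1).
    rewrite exprS mulrCA.
    have -> : ((2 * idx m x).+2 = 2 * (idx m x).+1)%N by rewrite mulnS.
    by rewrite natrM ltr_pM2l.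
- rewrite /grid e natrM exprS.
  have -> : 2 * (idx m x)%:R * L / (2 * 2 ^+ m) = (idx m x)%:R * L / 2 ^+ m.
    by field; rewrite ?expf_neq0.
  by rewrite subrr normr0 mulr_ge0// exprn_ge0// ltW.
- have -> : grid m x = (2 * idx m x)%:R * L / 2 ^+ m.+1.
    by rewrite /grid natrM exprS; field; rewrite ?expf_neq0.
  (* The increment starts at index 2 [idx m x], whose successor [idx m.+1 x] is at most 2^(m+1);
     hence [f_incr] applies even for x near L. *)
  rewrite /grid e; apply: (le_trans (f_incr m.+1 _ _)).
    by rewrite -e idx_le.
  by rewrite ler_wpM2l// exprS ler_piMl// ?exprn_ge0 ?(ltW r0) ?(ltW r1).
Qed.

(** Telescoping of [grid_step]. Keeping the partial geometric sum in closed form turns the induction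
    step into an identity. *)
Let grid_chain m n x : 0 <= x -> x <= L ->
  `|f (grid (m + n) x) - f (grid m x)| <= A * r ^+ m * ((1 - r ^+ n) / (1 - r)).
Proof.
move=> x0 xL; have /andP[r0 r1] := r01.
have r1' : 1 - r != 0 by rewrite subr_eq0 gt_eqF.
elim: n => [|n IH].
  by rewrite addn0 subrr normr0 expr0 subrr mul0r mulr0.
apply: (le_trans (ler_distD (f (grid (m + n) x)) _ _)).
rewrite addnS; apply: (le_trans (lerD (grid_step (m + n) x x0 xL) IH)).
rewrite le_eqVlt; apply/orP; left; apply/eqP.
by rewrite exprD exprS; field.
Qed.

Let grid_dist m x : 0 <= x -> `|x - grid m x| <= L / 2 ^+ m.
Proof.
move=> x0; have /andP[a1 a2] := idx_itv m x x0.
have L2 : 0 < L / 2 ^+ m by rewrite divr_gt0// exprn_gt0.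
have -> : x - grid m x = (L / 2 ^+ m) * (x / L * 2 ^+ m - (idx m x)%:R).
  by rewrite /grid; field; rewrite gt_eqF//= expf_neq0.
rewrite normrM gtr0_norm// ler_piMr ?(ltW L2)//.
rewrite ger0_norm ?subr_ge0// lerBlDr addrC natr1; exact: ltW.
Qed.

(** The grid points converge to x, so continuity of f lets n tend to infinity in [grid_chain]. *)
Let grid_lim m x : 0 <= x -> x <= L ->
  `|f x - f (grid m x)| <= A * r ^+ m / (1 - r).
Proof.
move=> x0 xL; have /andP[r0 r1] := r01.
apply/ler_addgt0Pr => e e0.
have /subspace_continuousP/(_ x) := f_cont.
rewrite /= in_itv/= x0 => /(_ erefl) /cvgrPdist_lt /(_ e e0).
rewrite near_withinE => -[d /= d0 fd].
have [n _ nd] := near_infty_natSinv_expn_lt (PosNum (divr_gt0 d0 L0)).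
have {nd} := nd (m + n)%N (leq_addl _ _); rewrite /= ltr_pdivlMr// => nd.
apply: (le_trans (ler_distD (f (grid (m + n) x)) _ _)).
rewrite addrC lerD//.
  apply: (le_trans (grid_chain m n x x0 xL)).
  rewrite ler_wpM2l ?mulr_ge0 ?exprn_ge0 ?(ltW r0)//.
  by rewrite ler_piMl ?invr_ge0 ?subr_ge0 ?(ltW r1)// lerBlDr lerDl exprn_ge0// ltW.
apply: ltW; apply: fd => /=.
  by apply: (le_lt_trans (grid_dist _ _ x0)); rewrite mulrC -div1r.
by rewrite in_itv/= andbT /grid !mulr_ge0 ?invr_ge0 ?exprn_ge0 ?(ltW L0).
Qed.

(** Points at distance at most L 2^-m have equal or adjacent grid points at level m. One increment
    joins the grid points, and two limits of chains, each costing 1/(1-r), join them to s and t. *)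
Lemma dyadic_modulus m s t : 0 <= s -> s <= t -> t <= L -> (t - s) / L <= 2 ^- m ->
  `|f t - f s| <= A * r ^+ m * (1 + 2 / (1 - r)).
Proof.
move=> s0 st tL ts; have /andP[r0 r1] := r01.
have t0 := le_trans s0 st; have sL := le_trans st tL.
have r1' : 1 - r != 0 by rewrite subr_eq0 gt_eqF.
have fst : `|f (grid m t) - f (grid m s)| <= A * r ^+ m.
  have [e|e] : idx m t = idx m s \/ idx m t = (idx m s).+1.
    apply: eq_or_succ.
      by rewrite /idx le_truncn// ler_pM2r ?exprn_gt0// ler_pM2r ?invr_gt0.
    - rewrite -(ltr_nat R); have /andP[+ _] := idx_itv m t t0.
      have /andP[_ +] := idx_itv m s s0.
      have : (t - s) / L * 2 ^+ m <= 1 by rewrite -ler_pdivlMr ?exprn_gt0// div1r.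
      rewrite !mulrBl.
      rewrite -[(idx m s).+2%:R]natr1; lra.
  - by rewrite /grid e subrr normr0 mulr_ge0// exprn_ge0// ltW.
  - rewrite /grid e; apply: f_incr; rewrite -e; exact: idx_le.
have ft := grid_lim m t t0 tL; have fs := grid_lim m s s0 sL.
have -> : A * r ^+ m * (1 + 2 / (1 - r)) =
  A * r ^+ m / (1 - r) + A * r ^+ m + A * r ^+ m / (1 - r) by field.
apply: (le_trans (ler_distD (f (grid m s)) _ _)); apply: lerD; last by rewrite distrC.
by apply: (le_trans (ler_distD (f (grid m t)) _ _)); apply: lerD.
Qed.

End dyadic.

(** Take the level m with 2^-(m+1) < (t-s)/L <= 2^-m. Then 2^(-hm) is at most 2^h ((t-s)/L)^h, which
    is the source of the factor 2^h. *)
Lemma dyadic_holder (R : realType) (f : R -> R) (L A h : R) :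
  0 < L -> 0 <= A -> 0 < h ->
  {within `[0, +oo[, continuous f} ->
  (forall m k, (k < 2 ^ m)%N ->
    `|f (k.+1%:R * L / 2 ^+ m) - f (k%:R * L / 2 ^+ m)| <= A * (2 `^ (- h)) ^+ m) ->
  forall s t, 0 <= s -> s <= t -> t <= L ->
  `|f t - f s| <= 2 `^ h * (1 + 2 / (1 - 2 `^ (- h))) * A * ((t - s) / L) `^ h.
Proof.
move=> L0 A0 h0 fc fi s t s0 st tL.
have r01 := powR2N_itv R h h0.
have /andP[r0 r1] := r01.
have [->|st'] := eqVneq s t.
  by rewrite !subrr normr0 !mulr_ge0 ?powR_ge0// addr_ge0// divr_ge0// subr_ge0 ltW.
have u0 : 0 < (t - s) / L by rewrite divr_gt0// subr_gt0 lt_neqAle st'.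
have u1 : (t - s) / L <= 1 by rewrite ler_pdivrMr// mul1r lerBlDr (le_trans tL)// lerDl.
have ex : exists n, 2 ^- n < (t - s) / L.
  have [n _ nd] := near_infty_natSinv_expn_lt (PosNum u0).
  by exists n; have := nd n (leqnn n); rewrite /= div1r.
have [[|m] mu mmin] := ex_minnP ex.
  by move: mu; rewrite expr0 invr1 ltNge u1.
have um : (t - s) / L <= 2 ^- m.
  by rewrite leNgt; apply/negP => /mmin; rewrite ltnn.
apply: (le_trans (dyadic_modulus _ _ _ _ _ L0 A0 r01 fc fi m s t s0 st tL um)).
have c0 : 0 <= 1 + 2 / (1 - 2 `^ (- h)) :> R.
  by rewrite addr_ge0// divr_ge0// subr_ge0 ltW.
have -> : 2 `^ h * (1 + 2 / (1 - 2 `^ (- h))) * A * ((t - s) / L) `^ h =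
  A * (2 `^ h * ((t - s) / L) `^ h) * (1 + 2 / (1 - 2 `^ (- h))) by ring.
rewrite ler_wpM2r// ler_wpM2l// -powRM// ?(ltW u0)//.
rewrite -powR_mulrn ?powR_ge0// -powRrM (_ : - h * m%:R = - m%:R * h) ?powRrM; last by ring.
rewrite ge0_ler_powR ?nnegrE ?powR_ge0 ?(ltW h0)//.
  by rewrite mulr_ge0// ltW.
rewrite powRN powR_mulrn//.
by rewrite -ler_pdivrMl// -invfM -exprS ltW.
Qed.

(** * Geometric series and integrals with a power singularity *)

Lemma nneseries_geometric_le (R : realType) (u : (\bar R)^nat) (a q : R) :
  0 <= a -> 0 < q < 1 -> (forall i, (0 <= u i)%E) ->
  (forall i, (u i <= (a * q ^+ i)%:E)%E) ->
  (\sum_(0 <= i <oo) u i <= (a / (1 - q))%:E)%E.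
Proof.
move=> a0 /andP[q0 q1] u0 ule.
apply: lime_le; first by apply: is_cvg_nneseries => n _ _.
apply: nearW => n.
apply: (@le_trans _ _ (\sum_(0 <= i < n) (a * q ^+ i)%:E)%E).
  by apply: lee_sum => i _.
rewrite sumEFin lee_fin.
have := @geometric_le_lim R n a q a0 q0.
by rewrite ger0_norm ?(ltW q0)//; exact.
Qed.

(* The rings [s + l/2^(k+1), s + l/2^k[ exhaust ]s, t[; on each of them the
   bound is constant up to a factor, and their contributions are geometric. *)
Lemma Rintegral_power_singularity (R : realType) (g : R -> R) (s t K b : R) :
  s < t -> 0 <= K -> 0 < b -> b <= 1 ->
  measurable_fun `]s, t[ g ->
  (forall u, s < u < t -> `|g u| <= K * (u - s) `^ (b - 1)) ->
  `|Rintegral (@lebesgue_measure R) `]s, t[ g| <=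
    K / (1 - 2 `^ (- b)) * (t - s) `^ b.
Proof.
move=> st K0 b0 b1 mg gK.
pose l := t - s; have l0 : 0 < l by rewrite subr_gt0.
pose F k : set R := `[s + l / 2 ^+ k.+1, s + l / 2 ^+ k[%classic.
pose q : R := 2 `^ (- b).
have r01 : 0 < q < 1 := powR2N_itv R b b0.
have l2 k : 0 < l / 2 ^+ k by rewrite divr_gt0// exprn_gt0.
have l2le i j : (i <= j)%N -> l / 2 ^+ j <= l / 2 ^+ i.
  by move=> ij; rewrite ler_pM2l// lef_pV2 ?posrE ?exprn_gt0// ler_eXn2l// ltr1n.
have FE : `]s, t[%classic = \bigcup_k F k.
  apply/seteqP; split => [u /=|u [k _]].
    rewrite in_itv/= => /andP[su ut].
    have us0 : 0 < (u - s) / l by rewrite divr_gt0// subr_gt0.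
    have ex : exists n, l / 2 ^+ n <= u - s.
      have [n _ nd] := near_infty_natSinv_expn_lt (PosNum us0).
      exists n; have := nd n (leqnn n); rewrite /= ltr_pdivlMr// => /ltW.
      by rewrite mulrC div1r.
    have [[|m] mu mmin] := ex_minnP ex.
      by move: mu; rewrite expr0 divr1 lerD2r leNgt ut.
    exists m => //; rewrite /F /= in_itv/= -lerBrDl mu/= -ltrBlDl ltNge.
    by apply/negP => /mmin; rewrite ltnn.
  rewrite /F /= !in_itv/= => /andP[u1 u2]; apply/andP; split.
    by apply: lt_le_trans u1; rewrite ltrDl.
  apply: (lt_le_trans u2); rewrite -lerBrDl.
  by have := l2le 0 k (leq0n k); rewrite expr0 divr1.
have tF : trivIset setT F.
  apply/trivIsetP => i j _ _; wlog ij : i j / (i < j)%N.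
    move=> wl; rewrite neq_lt => /orP[] ij.
      by apply: wl => //; rewrite neq_lt ij.
    by rewrite setIC; apply: wl => //; rewrite neq_lt ij.
  move=> _; apply/seteqP; split => // u []; rewrite /F /= !in_itv/=.
  move=> /andP[u1 _] /andP[_ u2].
  by have := le_lt_trans u1 u2; rewrite ltrD2l ltNge l2le.
have mF k : measurable (F k) by exact: measurable_itv.
have mag : measurable_fun `]s, t[ (fun u => `|(g u)%:E|%E).
  by apply: measurableT_comp => //; exact/measurable_EFinP.
have Fst k : F k `<=` `]s, t[ by rewrite FE; exact: bigcup_sup.
have IE : (\int[lebesgue_measure]_(u in `]s, t[) `|(g u)%:E| <=
    (K * l `^ b / (1 - q))%:E)%E.
  rewrite {1}FE ge0_integral_bigcup -?FE//.
  have Klb : 0 <= K * l `^ b by rewrite mulr_ge0// powR_ge0.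
  apply: nneseries_geometric_le => // [i|i].
    by apply: integral_ge0.
  (* As b - 1 <= 0, the bound is largest at the left end of the ring, at distance l/2^(i+1) from s.
     This distance is also the length of the ring, so the ring contributes at most K
     (l/2^(i+1))^b. *)
  pose c := K * (l / 2 ^+ i.+1) `^ (b - 1).
  apply: (@le_trans _ _ (\int[lebesgue_measure]_(u in F i) (cst c%:E) u)%E).
    apply: ge0_le_integral => //.
    - exact: mF.
    - exact: (measurable_funS (measurable_itv _) (Fst i) mag).
    move=> u Fu; rewrite lee_fin; apply: (@le_trans _ _ (K * (u - s) `^ (b - 1))).
      by apply: gK; have := Fst _ _ Fu; rewrite /= in_itv.
    move: Fu; rewrite /F/= in_itv/= -lerBrDl => /andP[Fu _].
    have us := lt_le_trans (l2 _) Fu.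
    rewrite /c ler_wpM2l// (_ : b - 1 = - (1 - b)); last by ring.
    rewrite !powRN lef_pV2 ?posrE ?powR_gt0//.
    by apply: ge0_ler_powR; rewrite ?nnegrE ?(ltW us) ?(ltW (l2 _)) ?subr_ge0.
  have muF : lebesgue_measure (F i) = (l / 2 ^+ i.+1)%:E.
    have half : l / 2 ^+ i = l / 2 ^+ i.+1 + l / 2 ^+ i.+1.
      by rewrite exprS; field; rewrite expf_neq0.
    rewrite /F lebesgue_measure_itv/= lte_fin ltrD2l half ltrDl l2 -EFinB.
    by congr EFin; ring.
  rewrite integral_cst; last exact: mF.
  rewrite [X in (_ * X)%E]muF -EFinM lee_fin.
  have -> : c * (l / 2 ^+ i.+1) = K * (l / 2 ^+ i.+1) `^ b.
    rewrite -(mulr_powRB1 (ltW (l2 _)) b0) /c; set x := l / _; ring.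
  rewrite -mulrA ler_wpM2l// powRM ?(ltW l0)// ?invr_ge0 ?exprn_ge0//.
  rewrite ler_wpM2l ?powR_ge0// /q -powR_mulrn ?powR_ge0// -powRrM.
  rewrite -[2 ^+ i.+1]powR_mulrn// -powRN -powRrM !mulNr [i.+1%:R * b]mulrC.
  by rewrite ler_powR ?ler1n// lerN2 ler_wpM2l ?(ltW b0)// ler_nat.
rewrite /Rintegral [leRHS](_ : _ = K * l `^ b / (1 - q)); last by rewrite mulrAC.
set I := (\int[_]_(_ in _) _)%E.
have : (`|I| <= (K * l `^ b / (1 - q))%:E)%E.
  apply: le_trans IE; apply: le_abse_integral; first exact: measurable_itv.
  exact/measurable_EFinP.
(* An infinite I would violate the bound, so the default value of [fine] at infinity never
   occurs. *)
by case: I => [r| |] //=; rewrite ?leye_eq.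
Qed.

(** The boundary term accounts for the 1 in the constant. The integrand is at most K
    (u-t2)^(h+alpha-2), integrable since h > 1 - alpha, and accounts for the fraction. *)
Lemma Xfrac_le (d : measure_display) (T : measurableType d) (R : realType)
    (alpha h K t1 t2 : R) (B : R -> T -> R) (w : T) :
  {within `[0, +oo[, continuous (fun t => B t w)} ->
  0 <= K -> 1 - alpha < h -> h <= 2 - alpha -> 0 <= t2 -> t2 < t1 ->
  (forall u, t2 <= u -> u <= t1 -> `|B u w - B t2 w| <= K * (u - t2) `^ h) ->
  `|Xfrac alpha B w t1 t2| <=
    K * (1 + 1 / (1 - 2 `^ (- (h + alpha - 1)))) * (t1 - t2) `^ (h + alpha - 1).
Proof.
move=> Bc K0 hlb hub t20 t21 BK.
rewrite /Xfrac mulrDr mulr1 mulrDl; apply: (le_trans (ler_normD _ _)); apply: lerD.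
  have t0 : 0 < t1 - t2 by rewrite subr_gt0.
  rewrite normrM normfV (ger0_norm (powR_ge0 _ _)).
  rewrite ler_pdivrMr ?powR_gt0//; apply: (le_trans (BK t1 (ltW t21) (lexx _))).
  rewrite -mulrA -powRD; last by rewrite (gt_eqF t0) implybT.
  by rewrite (_ : h + alpha - 1 + (1 - alpha) = h)//; ring.
rewrite mulrA mulr1; apply: Rintegral_power_singularity => //.
- by lra.
- by lra.
- rewrite (_ : (fun u => _) =
    (fun u => (B u w - B t2 w) * (u - t2) `^ (- (2 - alpha)))); last first.
    by apply/funext => u; rewrite powRN.
  apply: measurable_funM.
    apply: measurable_funB => //.
    apply: (measurable_funS (measurable_itv `[0, +oo[)).
      by move=> u /=; rewrite !in_itv/= andbT => /andP[/ltW + _]; exact: le_trans.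
    exact: subspace_continuous_measurable_fun.
  apply: (@measurableT_comp _ _ _ _ _ _ (fun x : R => x `^ (- (2 - alpha)))).
    exact: measurable_powR.
  exact: measurable_funB.
move=> u /andP[u1 u2].
have u0 : 0 < u - t2 by rewrite subr_gt0.
rewrite normrM normfV (ger0_norm (powR_ge0 _ _)).
rewrite ler_pdivrMr ?powR_gt0//; apply: (le_trans (BK u (ltW u1) (ltW u2))).
rewrite -mulrA -powRD; last by rewrite (gt_eqF u0) implybT.
by rewrite (_ : h + alpha - 1 - 1 + (2 - alpha) = h)//; ring.
Qed.

(** * Gaussian tails of the increments *)

Lemma measurable_norm_gt (R : realType) (x : R) : measurable [set y : R | x < `|y|].
Proof.
rewrite -[X in measurable X]setTI.
have -> : [set y : R | x < `|y|] = Num.norm @^-1` `]x, +oo[.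
  by apply/seteqP; split => y /=; rewrite in_itv/= andbT.
exact: (@normr_measurable R setT).
Qed.

Lemma measurable_gt_ereal (d : measure_display) (T : measurableType d)
    (R : realType) (f : T -> \bar R) (x : \bar R) :
  measurable_fun setT f -> measurable [set w | (x < f w)%E].
Proof.
move=> mf; rewrite -[X in measurable X]setTI.
have -> : [set w | (x < f w)%E] = f @^-1` `]x, +oo[.
  by apply/seteqP; split => w; rewrite /= in_itv/= andbT.
by apply: mf => //; exact: emeasurable_itv.
Qed.

(* The density with deviation s is at most 2 exp(- y^2/(4 s^2)) times the density with
   deviation 2 s, whose total mass is 1. *)
Lemma normal_prob_tail (R : realType) (s x : R) : 0 < s -> 0 <= x ->
  (normal_prob 0 s [set y | (x < `|y|)%R] <=
   (2 * expR (- (x ^+ 2 / (4 * s ^+ 2))))%:E)%E.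
Proof.
move=> s0 x0; rewrite /normal_prob.
have mA := measurable_norm_gt R x.
have s2 : 2 * s != 0 by rewrite mulf_neq0// gt_eqF.
pose c := 2 * expR (- (x ^+ 2 / (4 * s ^+ 2))).
have c0 : 0 <= c by rewrite mulr_ge0// expR_ge0.
have mpdf (t : R) D : measurable_fun D (EFin \o normal_pdf 0 t).
  by apply/measurable_funTS/measurable_EFinP; exact: measurable_normal_pdf.
apply: (@le_trans _ _ (\int[lebesgue_measure]_(y in [set y : R | (x < `|y|)%R])
    (c%:E * (normal_pdf 0 (2 * s) y)%:E))%E).
  apply: ge0_le_integral => //.
  - by move=> y _; rewrite lee_fin normal_pdf_ge0.
  - exact: mpdf.
  - by apply: measurable_funeM; exact: mpdf.
  move=> y /= xy; rewrite -EFinM lee_fin !normal_pdfE ?gt_eqF//.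
    rewrite /normal_peak /normal_fun !subr0.
    have -> : (2 * s) ^+ 2 * pi *+ 2 = 2 ^+ 2 * (s ^+ 2 * pi *+ 2) :> R.
      by rewrite exprMn; ring.
    rewrite [Num.sqrt (2 ^+ 2 * _)]sqrtrM ?sqr_ge0// sqrtr_sqr ger0_norm// invfM.
    rewrite /c.
    set k := (Num.sqrt _)^-1.
    have -> : 2 * expR (- (x ^+ 2 / (4 * s ^+ 2))) *
      (2^-1 * k * expR (- y ^+ 2 / ((2 * s) ^+ 2 *+ 2))) =
      k * (expR (- (x ^+ 2 / (4 * s ^+ 2))) *
        expR (- y ^+ 2 / ((2 * s) ^+ 2 *+ 2))).
      by field.
    apply: ler_wpM2l; first by rewrite invr_ge0 sqrtr_ge0.
    rewrite -expRD ler_expR.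
    have xy2 : x ^+ 2 <= y ^+ 2.
      by rewrite -(real_normK (num_real y)) ler_sqr ?nnegrE//= ltW.
    (* Of the two halves of the exponent, one is compared with x through |y| > x, and the other is
       smaller than the exponent - y^2/(8 s^2) of the wider density. *)
    have -> : - y ^+ 2 / (s ^+ 2 *+ 2) =
        - (y ^+ 2 / (4 * s ^+ 2)) - y ^+ 2 / (4 * s ^+ 2).
      by field; rewrite gt_eqF.
    apply: lerD.
      by rewrite lerN2 ler_pM2r// invr_gt0 mulr_gt0// exprn_gt0.
    have -> : - y ^+ 2 / ((2 * s) ^+ 2 *+ 2) = - (y ^+ 2 / (4 * s ^+ 2) / 2).
      by field; rewrite gt_eqF.
    rewrite lerN2 ler_pdivrMr// ler_peMr// ?ler1n//.
    by rewrite mulr_ge0 ?sqr_ge0// invr_ge0 mulr_ge0// sqr_ge0.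
  by rewrite mulr_gt0.
rewrite ge0_integralZl//; last first.
- by move=> y _; rewrite lee_fin normal_pdf_ge0.
- exact: mpdf.
rewrite -[leRHS]mule1; apply: lee_wpmul2l; first by rewrite lee_fin.
rewrite -(@integral_normal_pdf R 0 (2 * s)).
apply: ge0_subset_integral => //; first exact: mpdf.
by move=> y _; rewrite lee_fin normal_pdf_ge0.
Qed.

(** The increment is the linear combination with coefficients 1 and -1, and the covariance formula
    gives it the variance (t-s)^(2H), which is positive. *)
Lemma fBm_increment_tail (d : measure_display) (T : measurableType d)
    (R : realType) (P : probability T R) (H : R) (B : R -> T -> R) (s t x : R) :
  is_fBm P H B -> 0 < H -> 0 <= s -> s < t -> 0 <= x ->
  (P [set w | (x < `|B t w - B s w|)%R] <=
   (2 * expR (- (x ^+ 2 / (4 * (t - s) `^ (2 * H)))))%:E)%E.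
Proof.
move=> [_ [_ gB]] H0 s0 st x0.
have H20 : 2 * H != 0 by rewrite mulf_neq0// gt_eqF.
have ts0 : 0 < t - s by rewrite subr_gt0.
have := gB 2%N (fun i => if i == ord0 then t else s)
  (fun i => if i == ord0 then 1 else -1).
move=> []; first by move=> i; case: ifP => _ //; exact: le_trans (ltW st).
move=> _; rewrite !big_ord_recl !big_ord0/= !addr0.
set v := (X in if X == 0 then _ else _).
have vE : v = (t - s) `^ (2 * H).
  rewrite /v /fbm_cov !subrr normr0 powR0// [`|s - t|]distrC.
  by rewrite (gtr0_norm ts0); field.
rewrite vE gt_eqF ?powR_gt0//.
rewrite -/v vE.
have -> : Num.sqrt ((t - s) `^ (2 * H)) = (t - s) `^ H.
  by rewrite mulrC powRrM powR_mulrn ?powR_ge0// sqrtr_sqr ger0_norm ?powR_ge0.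
move=> /(_ _ (measurable_norm_gt R x)) PE.
have -> : [set w | (x < `|B t w - B s w|)%R] =
    (fun w => \sum_(i < 2) (if i == ord0 then 1 else -1) *
      B (if i == ord0 then t else s) w) @^-1` [set y | x < `|y|].
  by apply/seteqP; split => w /=; rewrite !big_ord_recl big_ord0/= addr0 mul1r mulN1r.
rewrite PE; apply: (le_trans (normal_prob_tail R _ x (powR_gt0 H ts0) x0)).
by rewrite [2 * H]mulrC powRrM powR_mulrn ?powR_ge0.
Qed.

Lemma fBm_measurable (d : measure_display) (T : measurableType d)
    (R : realType) (P : probability T R) (H : R) (B : R -> T -> R) (t : R) :
  is_fBm P H B -> 0 <= t -> measurable_fun setT (B t).
Proof.
move=> [_ [_ gB]] t0; have [//|+ _] := gB 1%N (fun=> t) (fun=> 1).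
by under eq_fun do rewrite big_ord1 mul1r.
Qed.

(** * Union bound for the supremum over scales, levels and intervals *)

Section triangular_sup.
Variables (d : measure_display) (T : measurableType d) (R : realType).
Variables (P : probability T R) (Z : nat -> nat -> nat -> T -> R) (b : R).
Hypotheses (b01 : 0 < b <= 1).
Hypothesis mZ : forall n m k, measurable_fun setT (Z n m k).
Hypothesis tailZ : forall n m k (x : R), 0 <= x ->
  (P [set w | (x < Z n m k w)%R] <=
   (2 * expR (- (x ^+ 2 / 4 * (n.+1%:R ^+ 2 * 2 `^ (2 * b * m%:R)))))%:E)%E.

(** The triples (n, m, k) are enumerated by one integer so that the supremum is that of a sequence.
    Codes outside the range k < 2^m give -oo, which is neutral for the supremum. *)
Let term (j : nat) (w : T) : \bar R :=
  if unpickle j is Some (n, m, k) then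
    if (k < 2 ^ m)%N then (Z n m k w)%:E else -oo%E
  else -oo%E.

Definition tri_sup (w : T) : \bar R := esups (term ^~ w) 0.

Lemma measurable_tri_sup : measurable_fun setT tri_sup.
Proof.
apply: measurable_fun_esups => j; rewrite /term.
case: (unpickle j) => [[[n m] k]|] //; case: (k < 2 ^ m)%N => //.
exact/measurable_EFinP.
Qed.

Lemma tri_sup_ge n m k w : (k < 2 ^ m)%N -> ((Z n m k w)%:E <= tri_sup w)%E.
Proof.
move=> km; apply: ereal_sup_ubound; exists (pickle (n, m, k)) => //=.
by rewrite /term pickleK km.
Qed.

(** Put a = x^2/4; the hypothesis says a b >= 1. From 2^y >= 1 + y ln 2 the exponent is at least a
    (1 + n + 2 b m ln 2), hence at least a + n ln 2 + 2 m ln 2. One m ln 2 cancels the number 2^m of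
    intervals, the other gives the decay in m. *)
Let exp_bound n m (x : R) : 4 / b <= x ^+ 2 ->
  2 ^+ m * expR (- (x ^+ 2 / 4 * (n.+1%:R ^+ 2 * 2 `^ (2 * b * m%:R)))) <=
  expR (- (x ^+ 2 / 4)) * 2^-1 ^+ n * 2^-1 ^+ m.
Proof.
move=> bx; have /andP[b0 b1] := b01.
have e2 : expR (ln 2) = 2 :> R by rewrite lnK// posrE.
have l20 : 0 < ln 2 :> R by rewrite ln_gt0// ltr1n.
have l21 : ln 2 <= 1 :> R.
  by rewrite -ler_expR e2; have := @expR_ge1Dx R 1; lra.
have q2 k : 2 ^+ k = expR (k%:R * ln 2) :> R by rewrite expRM_natl e2.
have qV2 k : 2^-1 ^+ k = expR (- (k%:R * ln 2)) :> R by rewrite expRN -q2 exprVn.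
rewrite !qV2 q2 -!expRD ler_expR.
set a := x ^+ 2 / 4.
have ab : 1 <= a * b by move: bx; rewrite ler_pdivrMr// /a; lra.
have a1 : 1 <= a by apply: (le_trans ab); rewrite ler_piMr// /a divr_ge0 ?sqr_ge0.
have pw : 1 + 2 * b * m%:R * ln 2 <= (2 : R) `^ (2 * b * m%:R).
  by rewrite /powR gt_eqF// expR_ge1Dx.
have nn : 0 <= n%:R :> R by [].
have n2 : 1 + n%:R <= (n.+1%:R : R) ^+ 2.
  by rewrite -natr1; nra.
have mm : 0 <= m%:R :> R by [].
have prod : 1 + n%:R + 2 * b * m%:R * ln 2 <= n.+1%:R ^+ 2 * 2 `^ (2 * b * m%:R) :> R.
  have c0 : 0 <= 2 * b * m%:R * ln 2 by rewrite !mulr_ge0// ltW.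
  apply: (@le_trans _ _ ((1 + n%:R) * (1 + 2 * b * m%:R * ln 2))).
    have : 0 <= n%:R * (2 * b * m%:R * ln 2) by rewrite mulr_ge0.
    lra.
  by apply: ler_pM => //; lra.
have ay : a * (1 + n%:R + 2 * b * m%:R * ln 2) <=
    a * (n.+1%:R ^+ 2 * 2 `^ (2 * b * m%:R)).
  by rewrite ler_wpM2l//; lra.
have t1 : n%:R * ln 2 <= a * n%:R.
  by rewrite mulrC ler_wpM2r//; lra.
have t2 : m%:R * ln 2 <= a * b * (m%:R * ln 2).
  by rewrite ler_peMl// mulr_ge0// ltW.
lra.
Qed.

(** The constant 8 is 2 from the single tail, doubled by the geometric series over m and doubled
    again by the one over n. *)
Lemma tri_sup_tail (x : R) : 0 <= x -> 4 / b <= x ^+ 2 ->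
  (P [set w | (x%:E < tri_sup w)%E] <= (8 * expR (- (x ^+ 2 / 4)))%:E)%E.
Proof.
move=> x0 bx.
pose E n m k := [set w | (x < Z n m k w)%R].
have mE n m k : measurable (E n m k).
  rewrite -[X in measurable X]setTI.
  have -> : E n m k = Z n m k @^-1` `]x, +oo[.
    by apply/seteqP; split => w; rewrite /E /= in_itv/= andbT.
  exact: mZ.
pose C n m := \big[setU/set0]_(k < 2 ^ m) E n m k.
have mC n m : measurable (C n m) by exact: bigsetU_measurable.
pose A n := \bigcup_m C n m.
have mA n : measurable (A n) by exact: bigcupT_measurable.
set e := expR (- (x ^+ 2 / 4)).
have e0 : 0 <= e by exact: expR_ge0.
have q01 : 0 < (2^-1 : R) < 1 by rewrite invr_gt0 invf_lt1// ltr0n ltr1n.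
have PC n m : (P (C n m) <= (2 * e * 2^-1 ^+ n * 2^-1 ^+ m)%:E)%E.
  apply: (@le_trans _ _ (\sum_(k < 2 ^ m) P (E n m k))%E).
    apply: (@content_subadditive d R T P (C n m) (E n m) (2 ^ m)%N); last exact: subset_refl.
      by move=> k _; exact: mE.
    exact: mC.
  apply: (@le_trans _ _ (\sum_(k < 2 ^ m)
      (2 * expR (- (x ^+ 2 / 4 * (n.+1%:R ^+ 2 * 2 `^ (2 * b * m%:R)))))%:E)%E).
    by apply: lee_sum => k _; exact: tailZ.
  rewrite sumEFin lee_fin sumr_const card_ord -[leLHS]mulr_natl natrX mulrCA.
  have -> : 2 * e * 2^-1 ^+ n * 2^-1 ^+ m = 2 * (e * 2^-1 ^+ n * 2^-1 ^+ m).
    by rewrite !mulrA.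
  by apply: ler_wpM2l => //; exact: exp_bound.
have PA n : (P (A n) <= (4 * e * 2^-1 ^+ n)%:E)%E.
  apply: (le_trans (measure_sigma_subadditive P (mC n) (mA n) _)) => //.
  apply: le_trans.
    apply: (nneseries_geometric_le _ _ _ _ _ q01 _ (PC n)) => //.
    by rewrite !mulr_ge0// exprn_ge0.
  by rewrite lee_fin le_eqVlt; apply/orP; left; apply/eqP; field.
have sub : [set w | (x%:E < tri_sup w)%E] `<=` \bigcup_n A n.
  move=> w /= /ereal_sup_gt[y [j _ <-]]; rewrite /term.
  case: (unpickle j) => [[[n m] k]|] //; case: ifPn => // km; rewrite lte_fin => xZ.
  exists n => //; exists m => //; rewrite /C -bigcup_mkord; exists k => //.
have mS := measurable_gt_ereal _ _ _ _ x%:E measurable_tri_sup.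
apply: (le_trans (measure_sigma_subadditive P mA mS sub)).
apply: le_trans.
  by apply: (nneseries_geometric_le _ _ _ _ _ q01 _ PA) => //; rewrite mulr_ge0.
by rewrite lee_fin le_eqVlt; apply/orP; left; apply/eqP; field.
Qed.

End triangular_sup.

(** * Normalised increments and the pathwise bound on X *)

Definition chaining_cst {R : realType} (h : R) : R :=
  2 `^ h * (1 + 2 / (1 - 2 `^ (- h))).

(** The factors come from [log_scale_le], [dyadic_holder] and [Xfrac_le], in this order. *)
Definition Xfrac_cst {R : realType} (h b : R) : R :=
  2 * expR 1 * chaining_cst h * (1 + 1 / (1 - 2 `^ (- b))).

Lemma chaining_cst_gt0 (R : realType) (h : R) : 0 < h -> 0 < chaining_cst h.
Proof.
move=> /powR2N_itv/andP[r0 r1]; rewrite /chaining_cst mulr_gt0 ?powR_gt0//.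
by rewrite addr_gt0// divr_gt0// subr_gt0.
Qed.

Lemma Xfrac_cst_gt0 (R : realType) (h b : R) : 0 < h -> 0 < b -> 0 < Xfrac_cst h b.
Proof.
move=> h0 /powR2N_itv/andP[r0 r1]; apply: mulr_gt0; last first.
  by rewrite addr_gt0// divr_gt0// subr_gt0.
apply: mulr_gt0; last exact: chaining_cst_gt0.
by rewrite mulr_gt0 ?expR_gt0.
Qed.

(** If n = 0, which covers all t < e because [truncn] is 0 on negatives, the left side is at most e
    and the 1 in the maximum suffices. If n >= 1, then n + 1 <= 2 ln t <= 2 |ln t|^p, and passing
    from e^n to e^(n+1) costs at most a factor e. *)
Lemma log_scale_le (R : realType) (t th p : R) : 0 < t -> 0 <= th <= 1 -> 1 <= p ->
  (Num.truncn (ln t)).+1%:R * expR (Num.truncn (ln t)).+1%:R `^ th <=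
    2 * expR 1 * Num.max (t `^ th * `|ln t| `^ p) 1.
Proof.
move=> t0 /andP[th0 th1] p1; set n := Num.truncn _.
have e1 : 1 <= expR 1 :> R by have := @expR_ge1Dx R 1; lra.
rewrite -expRM; case: (posnP n) => [->|n0].
  rewrite mul1r.
  apply: (@le_trans _ _ (expR 1 * 1)); first by rewrite mulr1 ler_expR mul1r.
  apply: ler_pM; [lra|lra|lra|].
  by rewrite le_max lexx orbT.
have n1 : 1 <= n%:R :> R by rewrite ler1n.
have nln : n%:R <= ln t.
  by have := leqnn n; rewrite {2}/n -(ltn_predK n0) truncn_gt_nat.
have lnp : ln t <= `|ln t| `^ p.
  rewrite ger0_norm; last lra.
  by apply: le1r_powR => //; lra.
apply: (@le_trans _ _ (2 * expR 1 * (t `^ th * `|ln t| `^ p))); last first.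
  by rewrite ler_wpM2l ?le_max ?lexx//; lra.
have tth : expR (n%:R * th) <= t `^ th.
  by rewrite /powR gt_eqF// ler_expR mulrC ler_wpM2l.
have eth : expR (n.+1%:R * th) <= expR 1 * expR (n%:R * th).
  by rewrite -expRD ler_expR -natr1 mulrDl mul1r addrC lerD2r.
have nn : n.+1%:R <= 2 * `|ln t| `^ p.
  by rewrite -natr1; lra.
have -> : 2 * expR 1 * (t `^ th * `|ln t| `^ p) =
  (2 * `|ln t| `^ p) * (expR 1 * t `^ th) by ring.
apply: ler_pM; [by []|exact: expR_ge0|exact: nn|].
by apply: (le_trans eth); rewrite ler_wpM2l// expR_ge0.
Qed.

(** The factor [n.+1] makes the tails summable over the scales; its price is the logarithm in the
    bound on X. *)
Definition dyadic_incr {T : Type} {R : realType} (H h : R) (B : R -> T -> R)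
    (n m k : nat) (w : T) : R :=
  `|B (k.+1%:R * expR n.+1%:R / 2 ^+ m) w - B (k%:R * expR n.+1%:R / 2 ^+ m) w| /
  (n.+1%:R * expR n.+1%:R `^ H * (2 `^ (- h)) ^+ m).

Lemma dyadic_incr_den_gt0 (R : realType) (H h : R) (n m : nat) :
  0 < n.+1%:R * expR n.+1%:R `^ H * (2 `^ (- h)) ^+ m :> R.
Proof. by rewrite !mulr_gt0// ?exprn_gt0// powR_gt0// expR_gt0. Qed.

(** By self-similarity the power L^H of the standard deviation (L 2^-m)^H cancels against the
    normalisation, leaving x multiplied by (n+1) 2^(b m). *)
Lemma dyadic_incr_tail (d : measure_display) (T : measurableType d)
    (R : realType) (P : probability T R) (H b : R) (B : R -> T -> R) n m k (x : R) :
  is_fBm P H B -> 0 < H -> 0 <= x ->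
  (P [set w | (x < dyadic_incr H (H - b) B n m k w)%R] <=
   (2 * expR (- (x ^+ 2 / 4 * (n.+1%:R ^+ 2 * 2 `^ (2 * b * m%:R)))))%:E)%E.
Proof.
move=> fB H0 x0.
set L := expR (n.+1%:R : R); have L0 : 0 < L by exact: expR_gt0.
set s := k%:R * L / 2 ^+ m; set t := k.+1%:R * L / 2 ^+ m.
have p2 : 0 < 2 ^+ m :> R by rewrite exprn_gt0.
have ts : t - s = L / 2 ^+ m.
  by rewrite /t /s -natr1; field; rewrite gt_eqF.
have s0 : 0 <= s by rewrite !mulr_ge0// ?invr_ge0 ltW.
have st : s < t by rewrite -subr_gt0 ts divr_gt0.
have den0 := @dyadic_incr_den_gt0 R H (H - b) n m.
set c := (X in 0 < X) in den0.
have -> : [set w | x < dyadic_incr H (H - b) B n m k w] =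
    [set w | x * c < `|B t w - B s w|].
  by apply/seteqP; split => w /=; rewrite /dyadic_incr ltr_pdivlMr.
apply: (le_trans (fBm_increment_tail _ _ _ _ _ _ _ _ _ fB H0 s0 st _)).
  by rewrite mulr_ge0// ltW.
rewrite lee_fin ler_pM2l// ler_expR lerN2 le_eqVlt; apply/orP; left; apply/eqP.
rewrite ts /c -/L.
have -> : (L / 2 ^+ m) `^ (2 * H) = (L `^ H * (2 `^ (- H)) ^+ m) ^+ 2.
  rewrite [2 * H]mulrC powRrM powR_mulrn ?powR_ge0//; congr (_ ^+ 2).
  rewrite powRM ?invr_ge0 ?(ltW L0) ?(ltW p2)//; congr (_ * _).
  rewrite -!powR_mulrn// ?powR_ge0// -powRN -!powRrM; congr (_ `^ _); ring.
have -> : (2 : R) `^ (2 * b * m%:R) = ((2 `^ b) ^+ m) ^+ 2.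
  rewrite -!powR_mulrn// ?powR_ge0// -!powRrM; congr (_ `^ _); ring.
have -> : (2 : R) `^ (- (H - b)) = 2 `^ b * 2 `^ (- H).
  by rewrite -powRD ?pnatr_eq0 ?implybT// opprB.
have LH0 : L `^ H != 0 by rewrite gt_eqF// powR_gt0.
have q0 : (2 `^ (- H)) ^+ m != 0 :> R by rewrite expf_neq0// gt_eqF// powR_gt0.
rewrite [(2 `^ b * _) ^+ m]exprMn.
move: ((2 `^ b) ^+ m) ((2 `^ (- H)) ^+ m) (L `^ H) q0 LH0 => u v l v0 l0.
by field; rewrite v0 l0.
Qed.

Lemma measurable_dyadic_incr (d : measure_display) (T : measurableType d)
    (R : realType) (P : probability T R) (H h : R) (B : R -> T -> R) n m k :
  is_fBm P H B -> measurable_fun setT (dyadic_incr H h B n m k).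
Proof.
move=> fB; have mB i : measurable_fun setT (B (i%:R * expR n.+1%:R / 2 ^+ m)).
  apply: (fBm_measurable _ _ _ _ _ _ _ fB).
  by rewrite !mulr_ge0// ?invr_ge0 ?exprn_ge0 ?expR_ge0.
apply: measurable_funM => //; apply: measurableT_comp => //.
exact: measurable_funB.
Qed.

(** The scale n = floor(ln t1) gives t1 <= L = e^(n+1). Powers of L arise three times: L^H from the
    normalisation, L^-h from rescaling the Hoelder bound, and L^b from (t1-t2)^b. As H - h = b, they
    combine to L^(2b) = L^(H+alpha-1). *)
Lemma Xfrac_le_dyadic (d : measure_display) (T : measurableType d)
    (R : realType) (H alpha p z t1 t2 : R) (B : R -> T -> R) (w : T) :
  let b := (H + alpha - 1) / 2 in
  0 < H < 1 -> 0 < alpha < 1 -> 0 < b -> 1 <= p ->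
  {within `[0, +oo[, continuous (fun t => B t w)} ->
  (forall n m k, (k < 2 ^ m)%N -> dyadic_incr H (H - b) B n m k w <= z) ->
  0 <= t2 -> t2 < t1 ->
  `|Xfrac alpha B w t1 t2| <= Num.max (t1 `^ (H + alpha - 1) * `|ln t1| `^ p) 1 *
    (Xfrac_cst (H - b) b * z).
Proof.
move=> b /andP[H0 H1] /andP[al0 al1] b0 p1 Bc Bz t20 t21.
have t10 := le_lt_trans t20 t21.
have h0 : 0 < H - b by rewrite /b; lra.
set h := H - b in h0 Bz *.
have hb : h + alpha - 1 = b by rewrite /h /b; field.
have z0 : 0 <= z.
  apply: le_trans (Bz 0 0 0 isT)%N.
  by rewrite divr_ge0// ltW// dyadic_incr_den_gt0.
pose n := Num.truncn (ln t1); pose L := expR (n.+1%:R : R).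
have L0 : 0 < L by exact: expR_gt0.
have tL : t1 <= L by rewrite -(lnK t10) ler_expR ltW// truncnS_gt.
pose A := z * (n.+1%:R * L `^ H).
have A0 : 0 <= A by rewrite !mulr_ge0// powR_ge0.
have hold : forall u, t2 <= u -> u <= t1 ->
    `|B u w - B t2 w| <= chaining_cst h * A / L `^ h * (u - t2) `^ h.
  move=> u tu ut.
  have fi m k : (k < 2 ^ m)%N ->
      `|B (k.+1%:R * L / 2 ^+ m) w - B (k%:R * L / 2 ^+ m) w| <= A * (2 `^ (- h)) ^+ m.
    move=> km; have := Bz n m k km.
    rewrite /dyadic_incr ler_pdivrMr ?dyadic_incr_den_gt0//.
    by have -> : A * (2 `^ (- h)) ^+ m =
      z * (n.+1%:R * L `^ H * (2 `^ (- h)) ^+ m) by rewrite /A -mulrA.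
  have := dyadic_holder _ (fun t => B t w) _ _ _ L0 A0 h0 Bc fi _ _ t20 tu
    (le_trans ut tL).
  rewrite -/(chaining_cst h) powRM ?subr_ge0 ?invr_ge0 ?(ltW L0)//.
  rewrite -[L^-1]powR_inv1 ?(ltW L0)// -powRrM mulN1r powRN.
  by rewrite mulrCA mulrC [_ * (_ `^ _)^-1]mulrC mulrA.
have D0 : 0 <= chaining_cst h := ltW (chaining_cst_gt0 _ _ h0).
have K0 : 0 <= chaining_cst h * A / L `^ h.
  by rewrite mulr_ge0 ?(mulr_ge0 D0 A0)// invr_ge0 powR_ge0.
have ha : 1 - alpha < h by lra.
have hA : h <= 2 - alpha by rewrite /h; lra.
apply: (le_trans (Xfrac_le _ _ _ _ _ _ _ _ _ _ Bc K0 ha hA t20 t21 hold)).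
rewrite hb; set G := 1 + _ / _.
have /andP[r0 r1] := powR2N_itv _ _ b0.
have G0 : 0 <= G by rewrite addr_ge0// divr_ge0// subr_ge0 ltW.
apply: (@le_trans _ _ (chaining_cst h * A / L `^ h * G * L `^ b)).
  apply: ler_wpM2l; first exact: mulr_ge0 K0 G0.
  apply: ge0_ler_powR; rewrite ?nnegrE ?(ltW b0) ?(ltW L0)//.
    by rewrite subr_ge0 ltW.
  by rewrite lerBlDr (le_trans tL)// lerDl.
have LE : L `^ H / L `^ h * L `^ b = L `^ (H + alpha - 1).
  rewrite -powRB ?(gt_eqF L0) ?implybT// -powRD ?(gt_eqF L0) ?implybT//.
  by congr (_ `^ _); rewrite /h /b; field.
have -> : chaining_cst h * A / L `^ h * G * L `^ b =
    (n.+1%:R * L `^ (H + alpha - 1)) * (chaining_cst h * G * z).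
  by rewrite -LE /A; ring.
have -> : forall M, M * (Xfrac_cst h b * z) =
    (2 * expR 1 * M) * (chaining_cst h * G * z).
  by move=> M; rewrite /Xfrac_cst -/G; ring.
apply: ler_wpM2r; first exact: mulr_ge0 (mulr_ge0 D0 G0) z0.
by apply: log_scale_le => //; apply/andP; split; rewrite /b in b0; lra.
Qed.

(** * The tail constants and the theorem *)

(* Below the threshold 5 c / b the target bound exceeds 1; above it, it decays
   slower than the tail exp(- (eps / c)^2 / 4). *)
Lemma gaussian_tail_adjust (R : realType) (c b eps E : R) : 0 < c -> 0 < b <= 1 ->
  0 <= eps -> `|E| <= 2 * eps ->
  let v := expR (- (E ^+ 2 / (2 * (10 * c / b) ^+ 2))) in
  (eps <= 5 * c / b -> 1 <= 2 * v) /\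
  (5 * c / b < eps -> 8 * expR (- ((eps / c) ^+ 2 / 4)) <= 2 * v).
Proof.
move=> c0 /andP[b0 b1] e0 Ee v.
have E2 : E ^+ 2 <= 4 * eps ^+ 2.
  have -> : 4 * eps ^+ 2 = (2 * eps) ^+ 2 by ring.
  by rewrite -(real_normK (num_real E)) ler_sqr ?nnegrE// mulr_ge0.
pose x := eps / c * b.
have x0 : 0 <= x by rewrite !mulr_ge0// ?invr_ge0 ltW.
have vE : E ^+ 2 / (2 * (10 * c / b) ^+ 2) <= x ^+ 2 / 50.
  (* With |E| <= 2 eps, the deviation 10 c / b makes the exponent at most 4 eps^2 b^2 / (200 c^2) =
     x^2/50. *)
  rewrite ler_pdivrMr; last by rewrite pmulr_rgt0// exprn_gt0// divr_gt0// mulr_gt0.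
  have -> : x ^+ 2 / 50 * (2 * (10 * c / b) ^+ 2) = 4 * eps ^+ 2 => //.
  by rewrite /x; field; rewrite !gt_eqF.
split=> [le|gt].
- have x5 : x <= 5.
    by move: le; rewrite /x ler_pdivlMr// mulrAC ler_pdivrMr.
  have x25 : x ^+ 2 <= 25 by nra.
  (* The exponent is at most 25/50, so v >= 1 - 1/2. *)
  have := expR_ge1Dx (- (E ^+ 2 / (2 * (10 * c / b) ^+ 2))); rewrite -/v; lra.
- have x5 : 5 < x.
    by move: gt; rewrite /x ltr_pdivrMr// [eps / c * b]mulrAC ltr_pdivlMr.
  pose y := eps / c; have yx : x <= y.
    by rewrite /x ler_piMr// divr_ge0// ltW.
  have x2y : x ^+ 2 <= y ^+ 2 by rewrite ler_sqr ?nnegrE// (le_trans x0).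
  have y25 : 25 <= y ^+ 2 by nra.
  rewrite -/y; move: (y ^+ 2) x2y y25 => Y x2Y Y25.
  (* Split 1/4 as 23/100 + 1/50: for Y >= 25 the first part absorbs the ratio 8/2 = 4, and the
     second is the decay of the target. *)
  have -> : expR (- (Y / 4)) = expR (- (Y * (23 / 100))) * expR (- (Y / 50)).
    by rewrite -expRD; congr expR; field.
  have Y3 : 3 <= Y * (23 / 100) by lra.
  have le4 : 4 * expR (- (Y * (23 / 100))) <= 1.
    rewrite expRN ler_pdivrMr ?expR_gt0// mul1r.
    by have := expR_ge1Dx (Y * (23 / 100)); lra.
  have lev : expR (- (Y / 50)) <= v.
    by rewrite ler_expR lerN2; apply: (le_trans vE); lra.
  have := expR_ge0 (- (Y / 50)).
  nra.
Qed.

Theorem theorem3p4 (d : measure_display) (T : measurableType d) (R : realType)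
    (P : probability T R) (H alpha : R) (B : R -> T -> R) :
  0 < H -> H < 1 -> 1 - H < alpha -> alpha < 1 ->
  is_fBm P H B ->
  forall p : R, 1 < p ->
  exists xi : T -> \bar R,
    measurable_fun setT xi /\
    (forall (w : T) (t1 t2 : R), 0 <= t2 -> t2 < t1 ->
       (`|Xfrac alpha B w t1 t2|%:E <=
        (Num.max (t1 `^ (H + alpha - 1) * `|ln t1| `^ p) 1)%:E * xi w)%E) /\
    exists B1 C1 gamma kappa : R,
      (0 < B1 /\ 0 < C1 /\ 0 < gamma /\ 0 < kappa /\ kappa < 1 /\
       kappa < 2 * gamma) /\
      forall eps : R,
        (2 * C1 + 1) `^ (2 * gamma / (2 * gamma + kappa)) < eps ->
        (P [set w | eps%:E < xi w] <=
         (2 * expR (- ((eps - eps `^ (kappa / (2 * gamma + kappa)) * (2 * C1 + 1)) ^+ 2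
                       / (2 * B1 ^+ 2))))%:E)%E.
Proof.
move=> H0 H1 Ha al1 fB p p1.
pose b := (H + alpha - 1) / 2; pose h := H - b.
have b0 : 0 < b by rewrite /b; lra.
have b1 : b <= 1 by rewrite /b; lra.
have h0 : 0 < h by rewrite /h /b; lra.
pose c := Xfrac_cst h b; have c0 : 0 < c by exact: Xfrac_cst_gt0.
pose Z := dyadic_incr H h B.
have mZ n m k : measurable_fun setT (Z n m k) by exact: measurable_dyadic_incr fB.
pose eta := tri_sup _ T _ Z.
have meta : measurable_fun setT eta by exact: measurable_tri_sup.
exists (fun w => c%:E * eta w)%E; split; first exact: measurable_funeM.
split.
  move=> w t1 t2 t20 t21.
  set M := Num.max _ _.
  have M1 : 1 <= M by rewrite le_max lexx orbT.
  have Zeta n m k : (k < 2 ^ m)%N -> ((Z n m k w)%:E <= eta w)%E by exact: tri_sup_ge.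
  (* On paths where [eta] is +oo the right side is +oo, as c and M are positive; -oo is excluded
     because [eta] dominates a real increment. *)
  case etaE : (eta w) => [z| |].
  - rewrite -!EFinM lee_fin; apply: Xfrac_le_dyadic => //.
    + by apply/andP; split; lra.
    + by apply/andP; split; lra.
    + exact: ltW.
    + by have [_ []] := fB.
    + by move=> n m k km; have := Zeta n m k km; rewrite etaE lee_fin.
  - by rewrite gt0_muley ?lte_fin// gt0_muley ?lte_fin ?leey//; lra.
  - by have := Zeta 0%N 0%N 0%N isT; rewrite etaE leeNy_eq.
(* These choices turn the threshold into 3^(2/3), the inner exponent into 1/3 and 2 C1 + 1 into 3;
   B1 is the deviation of [gaussian_tail_adjust]. *)
exists (10 * c / b), 1, 2^-1, 2^-1.
split; first by split; [rewrite divr_gt0// mulr_gt0//|lra].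
move=> eps.
have -> : 2 * 2^-1 / (2 * 2^-1 + 2^-1) = 2 / 3 :> R by field.
have -> : 2^-1 / (2 * 2^-1 + 2^-1) = 3^-1 :> R by field.
have -> : 2 * 1 + 1 = 3 :> R by ring.
move=> eps3.
have eps1 : 1 <= eps.
  rewrite -[leLHS](powRr0 3); apply: le_trans (ltW eps3).
  by rewrite ler_powR//; lra.
set E := eps - _.
have E2 : `|E| <= 2 * eps.
  (* From eps >= 1, E = eps - 3 eps^(1/3) lies between -2 eps and eps. *)
  have e3 : eps `^ 3^-1 <= eps by apply: ler1_powR => //; lra.
  have := powR_ge0 eps 3^-1.
  rewrite /E ler_norml; lra.
have e0 : 0 <= eps by lra.
have [small large] := gaussian_tail_adjust _ c b eps E c0 (introT andP (conj b0 b1)) e0 E2.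
have -> : [set w | (eps%:E < c%:E * eta w)%E] = [set w | ((eps / c)%:E < eta w)%E].
  by apply/seteqP; split => w /=; rewrite [eps / c]mulrC (EFinM c^-1) lte_pdivrMl.
have [le|gt] := leP eps (5 * c / b).
  apply: le_trans; first exact: probability_le1 (measurable_gt_ereal _ _ _ _ _ meta).
  by rewrite lee_fin; exact: small.
have ec : 0 <= eps / c by rewrite divr_ge0// ltW.
apply: (@le_trans _ _ (8 * expR (- ((eps / c) ^+ 2 / 4)))%:E).
  apply: (tri_sup_tail _ _ _ P Z b) => //.
  - by rewrite b0.
  - by move=> n m k x x0; exact: dyadic_incr_tail fB H0 x0.
  (* As 1/b >= 1, (5/b)^2 is at least 25/b, above the 4/b required by [tri_sup_tail]. *)
  - have : 5 / b < eps / c.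
      by rewrite ltr_pdivlMr// mulrAC.
    have : 1 <= b^-1 by rewrite invf_ge1.
    by move: (b^-1) (eps / c) => r y; nra.
by rewrite lee_fin; exact: large.
Qed.
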